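(* Let $r_1,r_2\in\mathbb{R}_+$ (nonnegative reals), $p\in[1,\infty]$, and let $q\in[1,\infty]$ satisfy $\frac1p+\frac1q=1$. Let $\widehat\mu\in\mathbb{R}^n$ and let $\widehat\Sigma\in\mathbb{R}^{n\times n}$ be symmetric positive semidefinite. Let $$K^\star\in\mathop{\mathrm{argmin}}_{K\in\mathcal{L}}\Big\{\mathrm{Tr}\big(\widehat\Sigma\,C(K)\big)+r_1\|C(K)\|_\infty+r_2\|C(K)\|_q\Big\},\qquad C(K):=(K-K^{o})^\top D\,(K-K^{o}).$$ Then the control policy $$\phi^\star(w):=K^\star(w-\widehat\mu)+K^{o}\widehat\mu$$ is an optimal solution to the distributionally robust regret optimal control problem $$\inf_{\phi\in\mathcal{A}}\ \sup_{P\in\mathcal{P}}\ \mathbb{E}_P\big[R(\phi(w),w)\big].$$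
   Context: System. Fix positive integers $T,n_x,n_u$ and put $n:=n_x(T+1)$, $m:=n_uT$. Consider $x_{t+1}=A_tx_t+B_tu_t+w_t$ for $t=0,\dots,T-1$, with given $A_t\in\mathbb{R}^{n_x\times n_x}$, $B_t\in\mathbb{R}^{n_x\times n_u}$. Define the trajectories $x:=(x_0,\dots,x_T)\in\mathbb{R}^n$, $u:=(u_0,\dots,u_{T-1})\in\mathbb{R}^m$, and $w:=(x_0,w_0,\dots,w_{T-1})\in\mathbb{R}^n$ (the initial state is the first block of $w$; write $w_{-1}:=x_0$). Then $x=Fu+Gw$, where $F\in\mathbb{R}^{n\times m}$ and $G\in\mathbb{R}^{n\times n}$ are the block lower triangular matrices determined by the dynamics: for block row $t\in\{0,\dots,T\}$, the $(t,k)$ block of $G$ is $A_{t-1}\cdots A_k$ for $k\le t$ (identity if $k=t$) and $0$ for $k>t$, $k\in\{0,\dots,T\}$; the $(t,s)$ block of $F$ is $A_{t-1}\cdots A_{s+1}B_s$ for $s<t$ (equal to $B_s$ if $s=t-1$) and $0$ for $s\ge t$, $s\in\{0,\dots,T-1\}$. Cost and regret. Let $Q\in\mathbb{R}^{n\times n}$ be symmetric positive semidefinite and $R\in\mathbb{R}^{m\times m}$ symmetric positive definite. The cost is $J(u,w):=x^\top Qx+u^\top Ru$ with $x=Fu+Gw$. The regret is $R(u,w):=J(u,w)-J(u^{o}(w),w)$, where $u^{o}(w):=\mathop{\mathrm{argmin}}_{u\in\mathbb{R}^m}J(u,w)$ (the regret function $R(\cdot,\cdot)$ is not to be confused with the matrix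 $R$). Put $D:=R+F^\top QF$ (symmetric positive definite) and $K^{o}:=-(R+F^\top QF)^{-1}F^\top QG$; one has $u^{o}(w)=K^{o}w$. Policies. $\mathcal{L}\subseteq\mathbb{R}^{m\times n}$ is the linear subspace of block lower triangular matrices $K$ with blocks $K_{t,k}\in\mathbb{R}^{n_u\times n_x}$, $t\in\{0,\dots,T-1\}$, $k\in\{0,\dots,T\}$, such that $K_{t,k}=0$ whenever $k>t$ (so $u=Kw+v$ means $u_t=v_t+\sum_{k=0}^tK_{t,k}w_{k-1}$). The set of admissible causal affine policies is $\mathcal{A}:=\{\phi(w)=Kw+v\mid (v,K)\in\mathbb{R}^m\times\mathcal{L}\}$. Norms. For $p\in[1,\infty)$ the Schatten $p$-norm $\|A\|_p$ of a matrix is $(\sum_i\sigma_i^p)^{1/p}$, with $\sigma_i$ its singular values; $\|A\|_\infty$ is the largest singular value. $\|\cdot\|_2$ applied to a vector is the Euclidean norm. Ambiguity set. $\mathcal{P}$ is the set of Borel probability measures $P$ on $\mathbb{R}^n$ (with finite second moments) such that $\|\mu-\widehat\mu\|_2^2\le r_1$ and $\|\Sigma-\widehat\Sigma\|_p\le r_2$, where $\mu:=\mathbb{E}_P[w]$ and $\Sigma:=\mathbb{E}_P[(w-\mu)(w-\mu)^\top]$. *)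

(* Defs.v *)
From HB Require Import structures.
From mathcomp Require Import all_boot all_order all_algebra.
From mathcomp Require Import polyrcf.
From mathcomp Require Import all_classical all_reals all_analysis.

Set Implicit Arguments.
Unset Strict Implicit.
Unset Printing Implicit Defensive.

Import Order.TTheory GRing.Theory Num.Theory.
Import numFieldNormedType.Exports.

Local Open Scope classical_set_scope.
Local Open Scope ring_scope.

Definition is_argmin (X : Type) (d : Order.disp_t) (Y : porderType d)
    (S : set X) (f : X -> Y) (x : X) : Prop :=
  S x /\ forall y, S y -> (f x <= f y)%O.

Definition qform (R : realType) (n : nat) (M : 'M[R]_n) (x : 'cV[R]_n) : R :=
  (x^T *m M *m x) 0 0.

Definition psdmx (R : realType) (n : nat) (M : 'M[R]_n) : Prop :=
  M^T = M /\ forall x : 'cV[R]_n, 0 <= qform M x.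

Definition pdmx (R : realType) (n : nat) (M : 'M[R]_n) : Prop :=
  M^T = M /\ forall x : 'cV[R]_n, x != 0 -> 0 < qform M x.

Definition norm2 (R : realType) (n : nat) (x : 'cV[R]_n) : R :=
  Num.sqrt (\sum_i x i 0 ^+ 2).

(* The square roots of the eigenvalues of A^T A, each repeated according to
   its multiplicity.  There are n of them rather than min(m, n); the extra ones
   are zero and do not contribute to any Schatten norm. *)
Definition singular_values (R : realType) (m n : nat) (A : 'M[R]_(m, n)) :
    seq R :=
  let chi := char_poly (A^T *m A) in
  flatten [seq nseq (mup x chi) (Num.sqrt x) | x <- rootsR chi].

(* Only meant for 1 <= p; the value at -oo is irrelevant. *)
Definition schatten (R : realType) (m n : nat) (p : \bar R)
    (A : 'M[R]_(m, n)) : R :=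
  match p with
  | r%:E => (\sum_(s <- singular_values A) s `^ r) `^ r^-1
  | +oo%E => \big[Num.max/0]_(s <- singular_values A) s
  | -oo%E => 0
  end.

(* The dimension N * d of a stack of N blocks of size d, in the form in which
   block matrices of the library are indexed. *)
Notation stack_dim N d := (\sum_(i < N) d)%N.

Section System.
Context (R : realType) (T nx nu : nat).
Variables (A : 'I_T -> 'M[R]_nx) (B : 'I_T -> 'M[R]_(nx, nu)).

Local Notation n := (stack_dim T.+1 nx).
Local Notation m := (stack_dim T nu).

(* A_{t-1} ... A_k, with decreasing indices from left to right; identity if
   t <= k. *)
Definition transition (t k : nat) : 'M[R]_nx :=
  \prod_(s <- rev (enum 'I_T) | (k <= s < t)%N) A s.

Definition Gmx : 'M[R]_n :=
  mxblock (p_ := fun=> nx) (q_ := fun=> nx)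
    (fun t k : 'I_T.+1 => if (k <= t)%N then transition t k else 0).

Definition Fmx : 'M[R]_(n, m) :=
  mxblock (p_ := fun=> nx) (q_ := fun=> nu)
    (fun (t : 'I_T.+1) (s : 'I_T) =>
       if (s < t)%N then transition t s.+1 *m B s else 0).

Variables (Q : 'M[R]_n) (Rm : 'M[R]_m).

(* Block 0 of the disturbance trajectory w is the initial state x_0 and block
   t.+1 is w_t. *)
Definition cost (u : 'cV[R]_m) (w : 'cV[R]_n) : R :=
  qform Q (Fmx *m u + Gmx *m w) + qform Rm u.

(* The clairvoyant control: a minimizer of the cost, selected by choice (it is
   unique as soon as Q >= 0 and Rm > 0). *)
Definition uo (w : 'cV[R]_n) : 'cV[R]_m :=
  get [set u | is_argmin setT (cost^~ w) u].

Definition regret (u : 'cV[R]_m) (w : 'cV[R]_n) : R :=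
  cost u w - cost (uo w) w.

Definition Dmx : 'M[R]_m := Rm + Fmx^T *m Q *m Fmx.

Definition Ko : 'M[R]_(m, n) := - (invmx Dmx *m Fmx^T *m Q *m Gmx).

Definition Cmx (K : 'M[R]_(m, n)) : 'M[R]_n := (K - Ko)^T *m Dmx *m (K - Ko).

End System.

Definition causal (R : realType) (T nx nu : nat) :
    set 'M[R]_(stack_dim T nu, stack_dim T.+1 nx) :=
  [set K | forall (t : 'I_T) (k : 'I_T.+1), (t < k)%N ->
     submxblock (p_ := fun=> nu) (q_ := fun=> nx) K t k = 0].

Definition policies (R : realType) (T nx nu : nat) :
    set ('cV[R]_(stack_dim T.+1 nx) -> 'cV[R]_(stack_dim T nu)) :=
  [set phi | exists v K, @causal R T nx nu K /\ phi = fun w => K *m w + v].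

(* R^n with its Borel sigma-algebra. *)
Notation borel_cV R n := (g_sigma_algebraType (@open 'cV[R]_n)).

Section Moments.
Context (R : realType) (n : nat) (P : probability (borel_cV R n) R).

Definition component (i : 'I_n) : borel_cV R n -> R := fun w : 'cV[R]_n => w i 0.

Definition finite_second_moments : Prop :=
  forall i, ('E_P[(fun w => component i w ^+ 2)%R] < +oo)%E.

(* [fine] loses nothing under finite second moments. *)
Definition mean : 'cV[R]_n := \col_i fine 'E_P[component i].

Definition covmx : 'M[R]_n :=
  \matrix_(i, j) fine (covariance P (component i) (component j)).

End Moments.

Definition ambiguity (R : realType) (n : nat) (p : \bar R) (r1 r2 : R)
    (muh : 'cV[R]_n) (Sigmah : 'M[R]_n) : set (probability (borel_cV R n) R) :=
  [set P | [/\ finite_second_moments P,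
               norm2 (mean P - muh) ^+ 2 <= r1 &
               schatten p (covmx P - Sigmah) <= r2]].

(* Main.v *)
(* Completing the square, the regret of u at w is qform D (u - Ko w), with
   D = Rm + F^T Q F positive definite.  For phi w = K w + v, the expected regret
   under P is therefore Tr(Sigma C(K)) + qform D ((K - Ko) mu + v), where mu and
   Sigma are the mean and the covariance of P.

   Over the ambiguity set, the first term is at most
   Tr(Sigmah C) + r2 |C|_q by Schatten duality, and equality is reached at
   Sigmah + Delta with Delta positive semidefinite, because C is.  If
   mu = muh + delta, the second term is at least qform C delta for one of the
   two signs of delta, so that its supremum is at least r1 |C|_oo; for
   v = (Ko - K) muh it is exactly qform C delta <= r1 |C|_oo.  Hence the worst
   case regret of (K, v) is bounded below by the function that Kstar minimizes,
   and this bound is attained for v = (Ko - K) muh.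

   Schatten duality is proved in orthonormal eigenbases: with U and V orthogonal
   and W = U V^T, the trace of V^T diag(d) V U^T diag(c) U is the sum of the
   W_ij^2 c_i d_j, and (W_ij^2) is doubly stochastic. *)

Require Import Defs.
From HB Require Import structures.
From mathcomp Require Import all_boot all_order all_algebra.
From mathcomp Require Import polyrcf complex ring lra.
From mathcomp Require Import all_classical all_reals all_analysis.
From mathcomp Require Import measurable_realfun.

Set Implicit Arguments.
Unset Strict Implicit.
Unset Printing Implicit Defensive.

Import Order.TTheory GRing.Theory Num.Theory.
Import numFieldNormedType.Exports.

Local Open Scope classical_set_scope.
Local Open Scope ring_scope.

(** * Spectral theorem for real symmetric matrices *)

Lemma sqmx_ge0 (R : realDomainType) n (x : 'rV[R]_n) : 0 <= (x *m x^T) 0 0.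
Proof. by rewrite mxE sumr_ge0// => i _; rewrite mxE -expr2 sqr_ge0. Qed.

Lemma sqmx_eq0 (R : realDomainType) n (x : 'rV[R]_n) :
  ((x *m x^T) 0 0 == 0) = (x == 0).
Proof.
apply/eqP/eqP => [|->]; last by rewrite mul0mx mxE.
rewrite mxE => /eqP; rewrite psumr_eq0; last first.
  by move=> i _; rewrite mxE -expr2 sqr_ge0.
move=> /allP x0; apply/rowP => i; rewrite mxE; apply/eqP.
by have := x0 i (mem_index_enum _); rewrite mxE -expr2 sqrf_eq0.
Qed.

(* A complex eigenvalue al + be i with eigenvector x + y i satisfies
   be (|x|^2 + |y|^2) = 0 by symmetry of M. *)
Lemma sym_eigenvalue (R : rcfType) n (M : 'M[R]_n.+1) :
  M^T = M -> exists a, eigenvalue M a.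
Proof.
move=> Msym.
have [[al be] /eigenvalueP[v vM v0]] :=
  @eigenvalue_closed R[i] _ (map_mx (real_complex R) M) isT.
pose x : 'rV[R]_n.+1 := map_mx (@complex.Re R) v.
pose y : 'rV[R]_n.+1 := map_mx (@complex.Im R) v.
have vE j : v 0 j = Complex (x 0 j) (y 0 j) by rewrite !mxE; case: (v 0 j).
have ME : forall j, (x *m M) 0 j = al * x 0 j - be * y 0 j /\
    (y *m M) 0 j = al * y 0 j + be * x 0 j.
  move=> j; have /rowP/(_ j) := vM; rewrite !mxE vE.
  rewrite (eq_bigr (fun k => Complex (x 0 k * M k j) (y 0 k * M k j)));
      last first.
    by move=> k _; rewrite vE !mxE /GRing.mul /= !mulr0 subr0 add0r.
  have ReS (F : 'I_n.+1 -> R[i]) :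
      complex.Re (\sum_k F k) = \sum_k complex.Re (F k).
    by apply: (big_morph (@complex.Re R)) => // -[? ?] [].
  have ImS (F : 'I_n.+1 -> R[i]) :
      complex.Im (\sum_k F k) = \sum_k complex.Im (F k).
    by apply: (big_morph (@complex.Im R)) => // -[? ?] [].
  move=> h; have := congr1 (@complex.Re R) h; rewrite ReS /= => ->.
  by have := congr1 (@complex.Im R) h; rewrite ImS /= => ->; split.
have xM : x *m M = al *: x - be *: y.
  by apply/rowP => j; rewrite (ME j).1 !mxE.
have yM : y *m M = al *: y + be *: x.
  by apply/rowP => j; rewrite (ME j).2 !mxE.
pose dot (u w : 'rV[R]_n.+1) := (u *m w^T) 0 0.
have dotC u w : dot u w = dot w u.
  by rewrite /dot -[w in RHS]trmxK -trmx_mul [RHS]mxE.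
have dotE u a c b w : dot (a *: u + b *: c) w = a * dot u w + b * dot c w.
  by rewrite /dot mulmxDl -!scalemxAl !mxE.
have h : dot x (y *m M) = dot (x *m M) y.
  by rewrite /dot trmx_mul Msym mulmxA.
have /eqP : be * (dot x x + dot y y) = 0.
  move: h; rewrite yM xM -scaleNr dotC !dotE (dotC y x) => h; lra.
have xx := sqmx_ge0 x; have yy := sqmx_ge0 y.
rewrite mulf_eq0 paddr_eq0// !sqmx_eq0.
move=> /orP[/eqP be0|/andP[/eqP x0 /eqP y0]]; last first.
  by case/eqP: v0; apply/rowP => j; rewrite vE x0 y0 !mxE.
move: xM yM; rewrite be0 !scale0r subr0 addr0 => xM yM; exists al.
(* The real and imaginary parts do not both vanish, and a nonzero one is a real eigenvector. *)
have [x0|x0] := eqVneq x 0; last by apply/eigenvalueP; exists x.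
apply/eigenvalueP; exists y => //; apply: contraNneq v0 => y0.
by apply/eqP/rowP => j; rewrite vE x0 y0 !mxE.
Qed.

Lemma unit_eigenvector (R : rcfType) n (M : 'M[R]_n.+1) :
  M^T = M -> exists a (v : 'rV[R]_n.+1), v *m v^T = 1%:M /\ v *m M = a *: v.
Proof.
move=> /sym_eigenvalue[a /eigenvalueP[v vM v0]].
have vv : 0 < (v *m v^T) 0 0 by rewrite lt_def sqmx_eq0 v0 sqmx_ge0.
exists a, ((Num.sqrt ((v *m v^T) 0 0))^-1 *: v); split; last first.
  by rewrite -scalemxAl vM !scalerA mulrC.
apply/matrixP => i j; rewrite !ord1 linearZ /= -scalemxAl -scalemxAr scalerA.
rewrite mxE -invfM -expr2 sqr_sqrtr ?ltW// mulVf ?gt_eqF//.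
by rewrite mxE eqxx.
Qed.

(* For v <> e, reflect through the hyperplane orthogonal to v - e. *)
Lemma householder (R : rcfType) n (e v : 'rV[R]_n) :
  e *m e^T = 1%:M -> v *m v^T = 1%:M ->
  exists P : 'M[R]_n, [/\ P^T = P, P *m P = 1%:M & e *m P = v].
Proof.
move=> e1 v1; have [->|ev] := eqVneq v e.
  by exists 1%:M; rewrite trmx1 !mulmx1.
pose z := v - e; have z0 : z != 0 by rewrite subr_eq0.
have evC : e *m v^T = v *m e^T.
  apply/matrixP => i j; rewrite !ord1 -[v in LHS]trmxK -[e in LHS]trmxK.
  by rewrite -trmx_mul mxE trmxK.
pose k := (e *m v^T) 0 0.
have ekE : e *m v^T = k%:M by exact: mx11_scalar.
have zz : z *m z^T = (2 * (1 - k))%:M.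
  rewrite /z linearB /= !mulmxBl !mulmxBr -evC e1 v1 ekE.
  by apply/matrixP => i j; rewrite !ord1 !mxE eqxx /=; ring.
have ez : e *m z^T = (k - 1)%:M.
  rewrite /z linearB /= !mulmxBr e1 ekE.
  by apply/matrixP => i j; rewrite !ord1 !mxE eqxx /=; ring.
have k1 : 1 - k != 0.
  have : (z *m z^T) 0 0 != 0 by rewrite sqmx_eq0.
  by rewrite zz mxE eqxx mulr1n mulf_eq0 negb_or => /andP[].
have vE : v = z + e by rewrite subrK.
(* As |z|^2 = 2 (1 - k), this is 2 / |z|^2, the coefficient of [z^T *m z] in the reflection. *)
pose c := (1 - k)^-1.
have cE : c * (2 * (1 - k)) * c = 2 * c by rewrite /c; field.
have cE1 : c * (k - 1) = -1 by rewrite /c; field.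
clearbody z c; pose W := z^T *m z; have WT : W^T = W by rewrite trmx_mul trmxK.
have WW : W *m W = (2 * (1 - k)) *: W.
  by rewrite /W -mulmxA (mulmxA z) zz mul_scalar_mx -scalemxAr.
have eW : e *m W = (k - 1) *: z by rewrite /W mulmxA ez mul_scalar_mx.
exists (1%:M - c *: W); split.
- by rewrite linearB /= trmx1 linearZ /= WT.
- rewrite mulmxBl mul1mx mulmxBr mulmx1 -scalemxAl -scalemxAr scalerA WW.
  rewrite scalerA.
  rewrite (_ : c * c * _ = 2 * c); last by rewrite -cE; ring.
  by clearbody W; apply/matrixP => i j; rewrite !mxE; ring.
- by rewrite mulmxBr mulmx1 -scalemxAr eW scalerA cE1 scaleN1r opprK addrC.
Qed.

(** Deflation: conjugation by a reflection that exchanges the first basis vector with a unit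
    eigenvector turns the first row into [a *: e]. By symmetry the first column has the same form,
    and the induction hypothesis diagonalizes the remaining block. *)
Theorem spectral_sym (R : rcfType) n (M : 'M[R]_n) : M^T = M ->
  exists (U : 'M[R]_n) (d : 'rV[R]_n),
    U *m U^T = 1%:M /\ M = U^T *m diag_mx d *m U.
Proof.
elim: n M => [|n IH] M Msym.
  by exists 1%:M, 0; split; apply/matrixP => -[].
have [a [v [v1 vM]]] := unit_eigenvector Msym.
pose e : 'rV[R]_(1 + n) := delta_mx 0 0.
have e1 : e *m e^T = 1%:M.
  rewrite /e trmx_delta mul_delta_mx.
  by apply/matrixP => i j; rewrite !ord1 !mxE.
have [P [Psym PP eP]] := householder e1 v1.
pose N : 'M[R]_(1 + n) := P *m M *m P.
have Nsym : N^T = N by rewrite /N !trmx_mul Psym Msym mulmxA.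
have NE : M = P *m N *m P.
  by rewrite /N !mulmxA PP mul1mx -mulmxA PP mulmx1.
have eN : e *m N = a *: e.
  by rewrite /N !mulmxA eP vM -scalemxAl -eP -mulmxA PP mulmx1.
clearbody N; have N0 (j : 'I_(1 + n)) : N 0 j = a * (0 == j)%:R.
  have : (e *m N) 0 j = a * (0 == j)%:R by rewrite eN !mxE eq_sym.
  by rewrite -rowE mxE.
have Nur : ursubmx N = 0.
  by apply/matrixP => i j; rewrite !ord1 !mxE lshift0 N0 mulr0.
have Nul : ulsubmx N = a%:M.
  by apply/matrixP => i j; rewrite !ord1 !mxE lshift0 N0 eqxx mulr1.
have Ndl : dlsubmx N = 0 by rewrite -[dlsubmx N]trmxK trmx_dlsub Nsym Nur trmx0.
have [U [d [UU dE]]] := IH (drsubmx N) (etrans (trmx_drsub N) (congr1 _ Nsym)).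
pose V : 'M[R]_(1 + n) := block_mx 1%:M 0 0 U.
have VV : V *m V^T = 1%:M.
  rewrite /V tr_block_mx mulmx_block !trmx0 trmx1 !mulmx0 !mul0mx !mulmx1.
  by rewrite !addr0 !add0r UU -scalar_mx_block.
have VN : V^T *m diag_mx (row_mx a%:M d) *m V = N.
  rewrite -[RHS]submxK Nur Nul Ndl dE /V diag_mx_row tr_block_mx !mulmx_block.
  rewrite !trmx0 trmx1 !mulmx0 !mul0mx !mulmx1 !mul1mx !addr0 !add0r.
  rewrite ?mulmx0 ?mul0mx ?addr0.
  by congr block_mx; apply/matrixP => i j; rewrite !ord1 !mxE eqxx.
exists (V *m P), (row_mx a%:M d); split.
  by rewrite trmx_mul Psym mulmxA -(mulmxA _ P P) PP mulmx1 VV.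
by rewrite NE -VN trmx_mul Psym !mulmxA.
Qed.

(** * Singular values of symmetric matrices *)

Lemma char_poly_similar (R : comNzRingType) n (U M : 'M[R]_n) :
  U *m U^T = 1%:M -> char_poly (U^T *m M *m U) = char_poly M.
Proof.
move=> UU.
have pU : map_mx polyC U *m (map_mx polyC U)^T = 1%:M.
  by rewrite map_trmx -map_mxM UU map_mx1.
rewrite /char_poly /char_poly_mx.
have -> : 'X%:M - map_mx polyC (U^T *m M *m U) =
  (map_mx polyC U)^T *m ('X%:M - map_mx polyC M) *m map_mx polyC U.
  rewrite mulmxBr mulmxBl !map_mxM /= -map_trmx mul_mx_scalar -scalemxAl.
  by rewrite (mulmx1C pU) scalemx1.
by rewrite !det_mulmx mulrAC -det_mulmx (mulmx1C pU) det1 mul1r.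
Qed.

Lemma char_poly_diag (R : comNzRingType) n (d : 'rV[R]_n) :
  char_poly (diag_mx d) = \prod_(x <- [seq d 0 i | i <- enum 'I_n]) ('X - x%:P).
Proof.
rewrite char_poly_trig ?diag_mx_is_trig// big_map big_enum /=.
by apply: eq_bigr => i _; rewrite mxE eqxx.
Qed.

(** Applied to the distinct roots of a characteristic polynomial, with [f] their multiplicity, this
    counts the eigenvalues listed in [singular_values]. *)
Lemma count_flatten_nseq (T : eqType) (f : T -> nat) (r : seq T) x : uniq r ->
  count_mem x (flatten [seq nseq (f y) y | y <- r]) = ((x \in r) * f x)%N.
Proof.
elim: r => //= y r IH /andP[yr ru].
rewrite count_cat count_nseq IH// in_cons /= eq_sym; have [->|//] := eqVneq x y.
by rewrite (negbTE yr) addn0.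
Qed.

Section Schatten.
Variable R : realType.

(** The basis that diagonalizes [M] also diagonalizes [M^T *m M], with eigenvalues the squares of
    the [d 0 i], whose square roots are absolute values. *)
Lemma perm_singular_values n (M U : 'M[R]_n) (d : 'rV[R]_n) :
  U *m U^T = 1%:M -> M = U^T *m diag_mx d *m U ->
  perm_eq (singular_values M) [seq `|d 0 i| | i <- enum 'I_n].
Proof.
move=> UU ME; pose d2 : 'rV[R]_n := \row_i (d 0 i ^+ 2).
have MM : M^T *m M = U^T *m diag_mx d2 *m U.
  rewrite ME !trmx_mul trmxK tr_diag_mx !mulmxA -(mulmxA _ U U^T) UU mulmx1.
  rewrite -(mulmxA U^T (diag_mx d)) mulmx_diag.
  by rewrite (_ : \row_j _ = d2)//; apply/rowP => i; rewrite !mxE expr2.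
rewrite /singular_values MM char_poly_similar// char_poly_diag.
set s := [seq d2 0 i | i <- _]; set chi := \prod_(_ <- _) _.
rewrite (_ : flatten _ =
    map Num.sqrt (flatten [seq nseq (mup x chi) x | x <- rootsR chi]));
    last first.
  rewrite map_flatten -map_comp; congr flatten.
  by apply: eq_map => x /=; rewrite map_nseq.
rewrite (_ : [seq `|d 0 i| | i <- _] = map Num.sqrt s); last first.
  by rewrite -[RHS]map_comp; apply: eq_map => i /=; rewrite mxE sqrtr_sqr.
(* Both lists contain x as often as its multiplicity as a root of [chi]. *)
apply: perm_map; apply/allP => x _ /=; apply/eqP.
have chi0 : chi != 0 by rewrite monic_neq0 ?monic_prod_XsubC.
rewrite count_flatten_nseq; last first.
  exact: (sorted_uniq lt_trans ltxx (sorted_roots _ _ _)).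
rewrite mu_prod_XsubC -(roots_on_rootsR chi0) in_itv /= root_prod_XsubC.
by case: (boolP (x \in s)) => [|/count_memPn->]; rewrite ?mul1n.
Qed.

(** Mirrors [schatten] on a vector of eigenvalues; the value at -oo is copied from there, so that
    the two agree for every [p]. *)
Definition lpnorm n (p : \bar R) (c : 'rV[R]_n) : R :=
  match p with
  | r%:E => (\sum_i `|c 0 i| `^ r) `^ r^-1
  | +oo%E => \big[Num.max/0]_i `|c 0 i|
  | -oo%E => 0
  end.

Lemma schatten_spectral n (M U : 'M[R]_n) (d : 'rV[R]_n) p :
  U *m U^T = 1%:M -> M = U^T *m diag_mx d *m U ->
  schatten p M = lpnorm p d.
Proof.
move=> UU ME; have h := perm_singular_values UU ME.
case: p => [r||] //=.
  by rewrite (perm_big _ h)/= big_map big_enum.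
rewrite (perm_big _ h)/= big_map big_enum //.
Qed.

End Schatten.

(** * Duality of Schatten norms *)

Section Duality.
Variable R : realType.

(** Separates the endpoints, where a maximum is paired with a sum, from the finite exponents above
    1, where Young's inequality applies. *)
Lemma conjugate_exponents_cases (p q : \bar R) :
  (1 <= p)%E -> (1 <= q)%E -> (p^-1 + q^-1 = 1)%E ->
  [\/ p = +oo%E /\ q = 1%E, p = 1%E /\ q = +oo%E |
    exists a b, [/\ p = a%:E, q = b%:E, 1 < a, 1 < b & a^-1 + b^-1 = 1]].
Proof.
case: p => [a||//]; last first.
  move=> _ _; rewrite invey add0e => h; constructor 1.
  by rewrite -[q]inveK h inve1.
case: q => [b||//]; last first.
  move=> _ _; rewrite invey adde0 => h; constructor 2.
  by rewrite -[a%:E]inveK h inve1.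
rewrite !lee_fin => a1 b1; have a0 : 0 < a by lra.
have b0 : 0 < b by lra.
(* If one exponent were 1, the inverse of the other, a positive real, would be 0. *)
rewrite !inver !gt_eqF// => -[ab]; constructor 3; exists a, b; split=> //.
  rewrite lt_neqAle a1 andbT; apply/negP => /eqP a1'.
  by move: ab; rewrite -a1' invr1 => h; have := invr_gt0 b; rewrite b0; lra.
rewrite lt_neqAle b1 andbT; apply/negP => /eqP b1'.
by move: ab; rewrite -b1' invr1 => h; have := invr_gt0 a; rewrite a0; lra.
Qed.

Lemma lpnorm1 n (c : 'rV[R]_n) : lpnorm 1 c = \sum_i `|c 0 i|.
Proof.
rewrite /= invr1 powRr1; last by apply: sumr_ge0 => i _; rewrite powR_ge0.
by apply: eq_bigr => i _; rewrite powRr1.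
Qed.

Lemma le_lpnormy n (c : 'rV[R]_n) i : `|c 0 i| <= lpnorm +oo c.
Proof. exact: (le_bigmax 0 (fun i => `|c 0 i|)). Qed.

Lemma lpnorm_ge0 n p (c : 'rV[R]_n) : 0 <= lpnorm p c.
Proof.
case: p => [r||] //=; first exact: powR_ge0.
by apply: (big_ind (fun x => 0 <= x)) => // x y x0 y0; rewrite le_max x0.
Qed.

Lemma lpnorm_powR n a (c : 'rV[R]_n) : 0 < a ->
  lpnorm a%:E c `^ a = \sum_i `|c 0 i| `^ a.
Proof.
move=> a0; rewrite /= -powRrM mulVf ?gt_eqF// powRr1//.
by apply: sumr_ge0 => i _; rewrite powR_ge0.
Qed.

Lemma lpnorm_eq0 n a (c : 'rV[R]_n) : 0 < a -> lpnorm a%:E c = 0 -> c = 0.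
Proof.
move=> a0 c0; have := lpnorm_powR c a0.
rewrite c0 powR0 ?gt_eqF// => /esym/eqP; rewrite psumr_eq0; last first.
  by move=> i _; exact: powR_ge0.
move=> /allP h; apply/rowP => i; rewrite mxE; apply/eqP.
by have := h i (mem_index_enum _); rewrite powR_eq0 normr_eq0 => /andP[].
Qed.

Lemma lpnorm_normalized n a (c : 'rV[R]_n) : 0 < a -> 0 < lpnorm a%:E c ->
  \sum_i (`|c 0 i| / lpnorm a%:E c) `^ a = 1.
Proof.
move=> a0 c0; have ca : 0 < lpnorm a%:E c `^ a by rewrite powR_gt0.
apply: (mulfI (lt0r_neq0 ca)); rewrite mulr1 [RHS]lpnorm_powR// big_distrr.
apply: eq_bigr => i _.
rewrite -[LHS]powRM ?divr_ge0 ?lpnorm_ge0// mulrC divfK//.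
exact: lt0r_neq0.
Qed.

(** Young's inequality bounds each product by [x i]^ a / a + y j [^ b / b]. Row sums reduce the
    first part to 1/a, column sums the second to 1/b. *)
Lemma doubly_stochastic_young n (w : 'M[R]_n) (x y : 'I_n -> R) (a b : R) :
  0 < a -> 0 < b -> a^-1 + b^-1 = 1 ->
  (forall i j, 0 <= w i j) -> (forall i, \sum_j w i j = 1) ->
  (forall j, \sum_i w i j = 1) ->
  (forall i, 0 <= x i) -> (forall j, 0 <= y j) ->
  \sum_i x i `^ a = 1 -> \sum_j y j `^ b = 1 ->
  \sum_i \sum_j w i j * (x i * y j) <= 1.
Proof.
move=> a0 b0 ab w0 wr wc x0 y0 x1 y1.
apply: (@le_trans _ _
    (\sum_i \sum_j (w i j * (x i `^ a / a) + w i j * (y j `^ b / b)))).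
  apply: ler_sum => i _; apply: ler_sum => j _.
  by rewrite -mulrDr; apply: ler_wpM2l => //; exact: conjugate_powR.
under eq_bigr do rewrite big_split /= -big_distrl /= wr mul1r.
rewrite big_split /= [X in _ + X]exchange_big /=.
under [X in _ + X]eq_bigr do rewrite -big_distrl /= wc mul1r.
by rewrite -!big_distrl /= x1 y1 !mul1r ab.
Qed.

(* After normalizing both vectors, this is Young's inequality averaged over the
   doubly stochastic weights. *)
Lemma doubly_stochastic_hoelder n (w : 'M[R]_n) (c d : 'rV[R]_n)
    (p q : \bar R) :
  (1 <= p)%E -> (1 <= q)%E -> (p^-1 + q^-1 = 1)%E ->
  (forall i j, 0 <= w i j) -> (forall i, \sum_j w i j = 1) ->
  (forall j, \sum_i w i j = 1) ->
  \sum_i \sum_j w i j * (c 0 i * d 0 j) <= lpnorm p d * lpnorm q c.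
Proof.
move=> p1 q1 pq w0 wr wc.
apply: (@le_trans _ _ (\sum_i \sum_j w i j * (`|c 0 i| * `|d 0 j|))).
  apply: ler_sum => i _; apply: ler_sum => j _; apply: ler_wpM2l => //.
  by rewrite -normrM ler_norm.
have [[-> ->]|[-> ->]|[a [b [-> -> a1 b1 ab]]]] :=
  conjugate_exponents_cases p1 q1 pq.
(* At an endpoint, one vector is bounded entrywise by its maximum, and the weights then sum to 1
   along the rows (here) or the columns (next case). *)
- rewrite lpnorm1 big_distrr; apply: ler_sum => i _ /=.
  rewrite -[leRHS]mul1r -(wr i) big_distrl; apply: ler_sum => j _ /=.
  by apply: ler_wpM2l => //; rewrite mulrC ler_wpM2r// le_lpnormy.
- rewrite lpnorm1 exchange_big big_distrl; apply: ler_sum => j _ /=.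
  rewrite -[leRHS]mul1r -(wc j) big_distrl; apply: ler_sum => i _ /=.
  by apply: ler_wpM2l => //; rewrite mulrC ler_wpM2l// le_lpnormy.
have a0 : 0 < a by lra.
have b0 : 0 < b by lra.
have : 0 <= lpnorm a%:E d by exact: lpnorm_ge0.
(* A vector of norm 0 cannot be normalized, but it is 0 and so is the double sum. *)
rewrite le_eqVlt => /predU1P[/esym/(lpnorm_eq0 a0) d0|al0].
  rewrite big1 ?mulr_ge0 ?lpnorm_ge0// => i _; rewrite big1// => j _.
  by rewrite d0 mxE normr0 !mulr0.
have : 0 <= lpnorm b%:E c by exact: lpnorm_ge0.
rewrite le_eqVlt => /predU1P[/esym/(lpnorm_eq0 b0) c0|be0].
  rewrite big1 ?mulr_ge0 ?lpnorm_ge0// => i _; rewrite big1// => j _.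
  by rewrite c0 mxE normr0 mul0r mulr0.
have dn := lpnorm_normalized a0 al0; have cn := lpnorm_normalized b0 be0.
move: (lpnorm a%:E d) (lpnorm b%:E c) al0 be0 dn cn => al be al0 be0 dn cn.
have alN := lt0r_neq0 al0; have beN := lt0r_neq0 be0.
have C0 i : 0 <= `|c 0 i| / be by rewrite divr_ge0// ltW.
have D0 i : 0 <= `|d 0 i| / al by rewrite divr_ge0// ltW.
(* The exponents are exchanged, since the vector [c] on the rows carries [b]. *)
have ba : b^-1 + a^-1 = 1 by rewrite addrC.
have := doubly_stochastic_young b0 a0 ba w0 wr wc C0 D0 cn dn.
rewrite -(ler_pM2l (mulr_gt0 al0 be0)) mulr1; apply: le_trans.
rewrite big_distrr ler_sum// => i _; rewrite big_distrr ler_sum// => j _ /=.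
rewrite le_eqVlt; apply/orP; left; apply/eqP.
move: `|c 0 i| `|d 0 j| (w i j) => x y z.
by field; rewrite alN beN.
Qed.

(** The extremal [d] is constant for p = +oo, concentrated on a largest entry of [c] for p = 1, and
    a power of [c] in between. Its nonnegativity later yields a positive semidefinite perturbation
    of the covariance. *)
Lemma hoelder_attained n (c : 'rV[R]_n) (p q : \bar R) r :
  (1 <= p)%E -> (1 <= q)%E -> (p^-1 + q^-1 = 1)%E -> 0 <= r ->
  (forall i, 0 <= c 0 i) ->
  exists d : 'rV[R]_n, [/\ forall i, 0 <= d 0 i, lpnorm p d <= r &
    \sum_i c 0 i * d 0 i = r * lpnorm q c].
Proof.
move=> p1 q1 pq r0 c0.
have [[-> ->]|[-> ->]|[a [b [-> -> a1 b1 ab]]]] :=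
  conjugate_exponents_cases p1 q1 pq.
- exists (const_mx r); split=> [i||]; first by rewrite mxE.
    by apply: bigmax_le => // i _; rewrite mxE ger0_norm.
  rewrite lpnorm1 big_distrr; apply: eq_bigr => i _.
  by rewrite mxE mulrC ger0_norm.
(* An empty vector has no largest entry, but both sides are then 0. *)
- case: n c c0 => [|n] c c0.
    exists 0; split=> [i||]; first by rewrite mxE.
      by rewrite lpnorm1 big_ord0.
    by rewrite /= !big_ord0 mulr0.
  have [i0 _ E] := eq_bigmax ord0 xpredT (fun i => `|c 0 i|) isT
    (fun i _ => normr_ge0 _).
  exists (r *: delta_mx 0 i0); split=> [i||].
  + by rewrite !mxE mulr_ge0.
  + rewrite lpnorm1 (bigD1 i0)//= big1 => [|i /negPf ii0].
      by rewrite !mxE !eqxx mulr1 addr0 ger0_norm.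
    by rewrite !mxE ii0 mulr0 normr0.
  + rewrite (bigD1 i0)//= big1 => [|i /negPf ii0].
      by rewrite !mxE !eqxx mulr1 addr0 /= E ger0_norm// mulrC.
    by rewrite !mxE ii0 !mulr0.
have a0 : 0 < a by lra.
have b0 : 0 < b by lra.
set be := lpnorm _ c.
have : 0 <= be by exact: lpnorm_ge0.
rewrite le_eqVlt => /predU1P[be0|be0].
  exists 0; split=> [i||]; first by rewrite mxE.
    rewrite /= big1 => [|i _]; first by rewrite powR0// invr_eq0 gt_eqF.
    by rewrite mxE normr0 powR0// gt_eqF.
  by rewrite -be0 mulr0 big1// => i _; rewrite mxE mulr0.
have beN := lt0r_neq0 be0; pose C i := `|c 0 i| / be.
have C0 i : 0 <= C i by rewrite divr_ge0// ltW.
(* Equality in Young's inequality requires x^a = y^b, hence the exponent b / a = b - 1. *)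
exists (\row_i (r * C i `^ (b - 1))); split=> [i||].
- by rewrite mxE mulr_ge0// powR_ge0.
- rewrite /= (eq_bigr (fun i => r `^ a * C i `^ b)) => [|i _].
    rewrite -big_distrr /= lpnorm_normalized// mulr1 -powRrM divff ?gt_eqF//.
    by rewrite powRr1.
  rewrite mxE ger0_norm ?mulr_ge0 ?powR_ge0// powRM ?powR_ge0// -powRrM.
  (* Conjugacy gives a + b = a b, that is (b - 1) a = b. *)
  congr (_ * _ `^ _); have : a^-1 * (a * b) + b^-1 * (a * b) = a * b.
    by rewrite -mulrDl ab mul1r.
  rewrite mulKf ?gt_eqF// mulrCA mulVf ?gt_eqF// mulr1; lra.
- transitivity (\sum_i r * be * C i `^ b).
    apply: eq_bigr => i _; rewrite mxE -[C i `^ b]mulr_powRB1//.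
    have cE : c 0 i = be * C i by rewrite /C ger0_norm// mulrC divfK.
    by rewrite [X in X * _]cE mulrACA [be * r]mulrC.
  by rewrite -big_distrr /= lpnorm_normalized// mulr1.
Qed.
End Duality.

(** * Positive semidefinite matrices, trace duality and extremal quadratic forms *)

Section MatrixFacts.
Variable R : realType.

Lemma norm2_sqr n (x : 'cV[R]_n) : norm2 x ^+ 2 = \sum_i x i 0 ^+ 2.
Proof. by rewrite sqr_sqrtr// sumr_ge0// => i _; rewrite sqr_ge0. Qed.

Lemma norm2_sqrE n (x : 'cV[R]_n) : norm2 x ^+ 2 = (x^T *m x) 0 0.
Proof.
by rewrite norm2_sqr mxE; apply: eq_bigr => i _; rewrite mxE expr2.
Qed.

Lemma norm2_orthogonal n (U : 'M[R]_n) (x : 'cV[R]_n) :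
  U *m U^T = 1%:M -> norm2 (U *m x) ^+ 2 = norm2 x ^+ 2.
Proof.
move=> UU; rewrite !norm2_sqrE trmx_mul -mulmxA (mulmxA U^T).
by rewrite (mulmx1C UU) mul1mx.
Qed.

Lemma qform_diag n (c : 'rV[R]_n) (x : 'cV[R]_n) :
  qform (diag_mx c) x = \sum_i c 0 i * x i 0 ^+ 2.
Proof.
rewrite /qform mul_mx_diag mxE; apply: eq_bigr => i _.
by rewrite !mxE; ring.
Qed.

Lemma qform_congr m n (N : 'M[R]_(m, n)) (M : 'M[R]_m) (x : 'cV[R]_n) :
  qform (N^T *m M *m N) x = qform M (N *m x).
Proof. by rewrite /qform trmx_mul !mulmxA. Qed.

Lemma psdmx_congr m n (N : 'M[R]_(m, n)) (M : 'M[R]_m) :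
  psdmx M -> psdmx (N^T *m M *m N).
Proof.
move=> [MT M0]; split=> [|x]; last by rewrite qform_congr.
by rewrite !trmx_mul trmxK MT mulmxA.
Qed.

Lemma psdmx_diag n (c : 'rV[R]_n) : (forall i, 0 <= c 0 i) -> psdmx (diag_mx c).
Proof.
move=> c0; split=> [|x]; first exact: tr_diag_mx.
by rewrite qform_diag sumr_ge0// => i _; rewrite mulr_ge0 ?sqr_ge0.
Qed.

Lemma psdmxD n (M N : 'M[R]_n) : psdmx M -> psdmx N -> psdmx (M + N).
Proof.
move=> [MT M0] [NT N0]; split=> [|x]; first by rewrite linearD /= MT NT.
by rewrite /qform mulmxDr mulmxDl mxE addr_ge0 ?M0 ?N0.
Qed.

(** The quadratic form takes the value [c 0 i] at the i-th eigenvector [U^T *m delta_mx i 0]. *)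
Lemma psdmx_spectral n (M : 'M[R]_n) : psdmx M ->
  exists (U : 'M[R]_n) (c : 'rV[R]_n),
    [/\ U *m U^T = 1%:M, M = U^T *m diag_mx c *m U & forall i, 0 <= c 0 i].
Proof.
move=> [MT M0]; have [U [c [UU ME]]] := spectral_sym MT.
exists U, c; split=> // i; have := M0 (U^T *m delta_mx i 0).
rewrite ME qform_congr mulmxA UU mul1mx qform_diag (bigD1 i)//= big1 => [|j ji].
  by rewrite mxE !eqxx expr1n mulr1 addr0.
by rewrite mxE (negPf ji) expr0n mulr0.
Qed.

Lemma tr_schatten_le n (M N : 'M[R]_n) (p q : \bar R) :
  (1 <= p)%E -> (1 <= q)%E -> (p^-1 + q^-1 = 1)%E -> M^T = M -> N^T = N ->
  \tr (M *m N) <= schatten p M * schatten q N.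
Proof.
move=> p1 q1 pq MT NT.
have [V [d [VV ME]]] := spectral_sym MT.
have [U [c [UU NE]]] := spectral_sym NT.
rewrite (schatten_spectral p VV ME) (schatten_spectral q UU NE).
(* The entries are the inner products of the eigenvectors of [N] with those of [M]; orthogonality of
   [W] makes their squares doubly stochastic. *)
pose W := U *m V^T.
have WW : W *m W^T = 1%:M.
  by rewrite /W trmx_mul trmxK mulmxA -(mulmxA U) (mulmx1C VV) mulmx1.
have WTW := mulmx1C WW.
have -> : \tr (M *m N) = \sum_i \sum_j W i j ^+ 2 * (c 0 i * d 0 j).
  rewrite mxtrace_mulC ME NE.
  rewrite (_ : \tr _ = \tr (diag_mx c *m W *m diag_mx d *m W^T)); last first.
    by rewrite -!mulmxA mxtrace_mulC /W trmx_mul trmxK !mulmxA.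
  rewrite /mxtrace; apply: eq_bigr => i _.
  rewrite mul_diag_mx mul_mx_diag mxE; apply: eq_bigr => j _.
  by clearbody W; rewrite !mxE; ring.
have := @doubly_stochastic_hoelder R n (\matrix_(i, j) (W i j ^+ 2)) c d
  p q p1 q1 pq.
have WE : (\sum_i \sum_j (\matrix_(i, j) (W i j ^+ 2)) i j * (c 0 i * d 0 j) =
  \sum_i \sum_j W i j ^+ 2 * (c 0 i * d 0 j)).
  by apply: eq_bigr => i _; apply: eq_bigr => j _; rewrite mxE.
rewrite WE; apply.
- by move=> i j; rewrite mxE sqr_ge0.
- move=> i; have /matrixP/(_ i i) := WW.
  rewrite mxE [RHS]mxE eqxx mulr1n => <-.
  by apply: eq_bigr => j _; rewrite !mxE expr2.
- move=> i; have /matrixP/(_ i i) := WTW.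
  rewrite mxE [RHS]mxE eqxx mulr1n => <-.
  by apply: eq_bigr => j _; rewrite !mxE expr2.
Qed.

(** Taking [M] diagonal in an eigenbasis of [N] reduces the trace to the equality case of the vector
    inequality. *)
Lemma tr_schatten_attained n (N : 'M[R]_n) (p q : \bar R) r :
  (1 <= p)%E -> (1 <= q)%E -> (p^-1 + q^-1 = 1)%E -> 0 <= r -> psdmx N ->
  exists M : 'M[R]_n,
    [/\ psdmx M, schatten p M <= r & \tr (M *m N) = r * schatten q N].
Proof.
move=> p1 q1 pq r0 /psdmx_spectral[U [c [UU NE c0]]].
have [d [d0 dr cd]] := hoelder_attained p1 q1 pq r0 c0.
exists (U^T *m diag_mx d *m U); split.
- exact/psdmx_congr/psdmx_diag.
- by rewrite (schatten_spectral p UU erefl).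
- rewrite (schatten_spectral q UU NE) -cd NE !mulmxA -(mulmxA _ U) UU mulmx1.
  rewrite mxtrace_mulC !mulmxA UU mul1mx mulmx_diag; apply: eq_bigr => i _.
  by rewrite !mxE eqxx mulrC.
Qed.

Lemma qform_le_schatten n (N : 'M[R]_n) (x : 'cV[R]_n) : N^T = N ->
  qform N x <= schatten +oo N * norm2 x ^+ 2.
Proof.
move=> NT; have [U [c [UU NE]]] := spectral_sym NT.
rewrite (schatten_spectral +oo UU NE) -(norm2_orthogonal x UU) NE qform_congr.
rewrite qform_diag norm2_sqr big_distrr; apply: ler_sum => i _.
by apply: ler_wpM2r; rewrite ?sqr_ge0// (le_trans (ler_norm _)) ?le_lpnormy.
Qed.

(** The witness is a unit eigenvector for the largest eigenvalue, which is the operator norm because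
    no eigenvalue is negative. *)
Lemma qform_schatten_attained n (N : 'M[R]_n) : (0 < n)%N -> psdmx N ->
  exists x : 'cV[R]_n, norm2 x ^+ 2 = 1 /\ qform N x = schatten +oo N.
Proof.
move=> n0 /psdmx_spectral[U [c [UU NE c0]]].
have [i _ ci] := eq_bigmax (Ordinal n0) xpredT (fun i => `|c 0 i|) isT
  (fun i _ => normr_ge0 _).
have sqE (F : 'I_n -> R) :
    \sum_j F j * (delta_mx i 0 : 'cV[R]_n) j 0 ^+ 2 = F i.
  rewrite (bigD1 i)//= big1 => [|j ji].
    by rewrite mxE !eqxx expr1n mulr1 addr0.
  by rewrite mxE (negPf ji) expr0n mulr0.
have UTU : U^T *m U^T^T = 1%:M by rewrite trmxK (mulmx1C UU).
exists (U^T *m delta_mx i 0); split.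
  rewrite (norm2_orthogonal _ UTU) norm2_sqr -[RHS](sqE (fun=> 1)).
  by apply: eq_bigr => j _; rewrite mul1r.
rewrite (schatten_spectral +oo UU NE) NE qform_congr mulmxA UU mul1mx.
by rewrite qform_diag sqE /= ci ger0_norm.
Qed.
End MatrixFacts.

(** * Regret *)

Section Qform.
Variable R : realType.

Lemma qformD n (M : 'M[R]_n) (x y : 'cV[R]_n) : M^T = M ->
  qform M (x + y) = qform M x + 2 * (y^T *m M *m x) 0 0 + qform M y.
Proof.
move=> MT; have xyC : (x^T *m M *m y) 0 0 = (y^T *m M *m x) 0 0.
  by rewrite -[RHS]trace_mx11 -mxtrace_tr !trmx_mul trmxK MT mulmxA trace_mx11.
rewrite /qform [(x + y)^T]linearD /= !mulmxDl !mulmxDr.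
rewrite mxE [X in X + _ = _]mxE [X in _ + X = _]mxE xyC; ring.
Qed.

Lemma pdmx_unit n (M : 'M[R]_n) : pdmx M -> M \in unitmx.
Proof.
move=> [MT M0]; rewrite unitmxE unitfE; apply/det0P => -[v v0 vM].
have := M0 v^T; rewrite /qform trmxK vM mul0mx mxE ltxx trmx_eq0.
by move=> /(_ v0).
Qed.

Lemma pdmxD_psdmx n (M N : 'M[R]_n) : pdmx M -> psdmx N -> pdmx (M + N).
Proof.
move=> [MT M0] [NT N0]; split=> [|x x0]; first by rewrite linearD /= MT NT.
by rewrite /qform mulmxDr mulmxDl mxE ltr_wpDr ?M0 ?N0.
Qed.

Lemma pdmx_psdmx n (M : 'M[R]_n) : pdmx M -> psdmx M.
Proof.
move=> [MT M0]; split=> // x; have [->|x0] := eqVneq x 0; last exact/ltW/M0.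
by rewrite /qform mulmx0 mxE.
Qed.
End Qform.

Section Regret.
Context (R : realType) (T nx nu : nat).
Variables (A : 'I_T -> 'M[R]_nx) (B : 'I_T -> 'M[R]_(nx, nu)).
Local Notation n := (stack_dim T.+1 nx).
Local Notation m := (stack_dim T nu).
Variables (Q : 'M[R]_n) (Rm : 'M[R]_m).
Hypotheses (hQ : psdmx Q) (hRm : pdmx Rm).
Local Notation D := (Dmx A B Q Rm).
Local Notation Ko := (Ko A B Q Rm).

Lemma Dmx_pd : pdmx D.
Proof. exact: pdmxD_psdmx hRm (psdmx_congr _ hQ). Qed.

(** [Ko *m w] is a stationary point of the quadratic cost, so the expansion around it has no linear
    term. *)
Lemma cost_completed_square u w :
  cost A B Q Rm u w = cost A B Q Rm (Ko *m w) w + qform D (u - Ko *m w).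
Proof.
set u0 := Ko *m w; pose h : 'cV[R]_m := u - u0.
have -> : u = u0 + h by rewrite addrC subrK.
clearbody h.
(* The left-hand side is half the gradient of the cost at [u0]. *)
have grad : (Fmx A B)^T *m (Q *m (Fmx A B *m u0 + Gmx A *m w)) + Rm *m u0 = 0.
  have -> : (Fmx A B)^T *m (Q *m (Fmx A B *m u0 + Gmx A *m w)) + Rm *m u0 =
      D *m u0 + (Fmx A B)^T *m Q *m Gmx A *m w.
    by rewrite /Dmx mulmxDl !mulmxDr !mulmxA addrC addrA.
  rewrite /u0 /Defs.Ko mulNmx mulmxN !mulmxA mulmxV ?pdmx_unit ?mul1mx ?addNr//.
  exact: Dmx_pd.
rewrite [u0 + h - u0]addrAC subrr add0r /cost mulmxDr addrAC.
rewrite (qformD _ (Fmx A B *m h) hQ.1) (qformD _ h hRm.1).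
have cross : (h^T *m ((Fmx A B)^T *m
    (Q *m (Fmx A B *m u0 + Gmx A *m w)) + Rm *m u0)) 0 0 = 0.
  by rewrite grad mulmx0 mxE.
move: cross; rewrite mulmxDr mxE.
have -> : qform D h = qform Rm h + qform Q (Fmx A B *m h).
  by rewrite -[X in _ + X]qform_congr /qform /Dmx mulmxDr mulmxDl [LHS]mxE.
rewrite trmx_mul !mulmxA => cross; lra.
Qed.

Lemma regretE u w : regret A B Q Rm u w = qform D (u - Ko *m w).
Proof.
have Kmin : is_argmin setT (cost A B Q Rm ^~ w) (Ko *m w).
  split=> // v _; rewrite (cost_completed_square v) lerDl.
  exact: (pdmx_psdmx Dmx_pd).2.
(* [uo] is selected by choice, but the regret depends on it only through its cost, and two
   minimizers have the same cost. *)
have [_ /(_ _ I) uo1] := getPex (ex_intro _ _ Kmin).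
have uoE : cost A B Q Rm (uo A B Q Rm w) w = cost A B Q Rm (Ko *m w) w.
  by apply/le_anti; rewrite uo1 Kmin.2.
by rewrite /regret uoE cost_completed_square addrC addKr.
Qed.

End Regret.

(** * Means and covariances *)

Section HasMean.
Context d (T : measurableType d) (R : realType) (P : probability T R).

(** Carrying integrability along with the value makes linearity of expectation compositional. *)
Definition has_mean (X : T -> R) (r : R) :=
  X \in Lfun P 1 /\ ('E_P[X])%E = r%:E.

Lemma has_mean_cst r : has_mean (fun=> r) r.
Proof. by split; [exact: Lfun_cst | exact: expectation_cst]. Qed.

Lemma has_meanD X Y r s :
  has_mean X r -> has_mean Y s -> has_mean (fun w => X w + Y w) (r + s).
Proof.
move=> [LX EX] [LY EY]; split; first exact: rpredD.
by rewrite EFinD -EX -EY -expectationD.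
Qed.

Lemma has_meanZ k X r : has_mean X r -> has_mean (fun w => k * X w) (k * r).
Proof.
move=> [LX EX]; have -> : (fun w => k * X w) = k \o* X.
  by apply/funext => w /=; rewrite mulrC.
split; first exact: Lfun_scale.
by rewrite expectationZl// EX.
Qed.

Lemma has_mean_sum (I : Type) (s : seq I) (X : I -> T -> R) (r : I -> R) :
  (forall i, has_mean (X i) (r i)) ->
  has_mean (fun w => \sum_(i <- s) X i w) (\sum_(i <- s) r i).
Proof.
move=> Xr; elim: s => [|i s IH].
  rewrite big_nil (_ : (fun _ => _) = fun=> 0); first exact: has_mean_cst.
  by apply/funext => w; rewrite big_nil.
rewrite big_cons (_ : (fun _ => _) = fun w => X i w + \sum_(j <- s) X j w).
  exact: has_meanD.
by apply/funext => w; rewrite big_cons.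
Qed.

Lemma has_mean_fine X : X \in Lfun P 1 -> has_mean X (fine 'E_P[X]%E).
Proof. by move=> LX; split=> //; rewrite fineK ?expectation_fin_num. Qed.

Lemma Lfun1_dominated (X Y : T -> R) :
  measurable_fun setT X -> Y \in Lfun P 1 ->
  (forall w, `|X w| <= Y w) -> X \in Lfun P 1.
Proof.
move=> mX /Lfun1_integrable iY XY; apply/Lfun1_integrable.
apply: (le_integrable _ _ _ iY) => //; first exact/measurable_EFinP.
by move=> w _ /=; rewrite lee_fin (le_trans (XY w))// ler_norm.
Qed.

Lemma sqr_Lfun1 (X : T -> R) : measurable_fun setT X ->
  ('E_P[(fun w => X w ^+ 2)%R] < +oo)%E -> (fun w => X w ^+ 2) \in Lfun P 1.
Proof.
move=> mX; rewrite unlock => EX; apply/Lfun1_integrable/integrableP; split.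
  by apply/measurable_EFinP; exact: measurable_funX.
rewrite (eq_integral (fun w => (X w ^+ 2)%:E))// => w _ /=.
by rewrite ger0_norm// sqr_ge0.
Qed.

(** Domination by |x y| <= x^2 + y^2. *)
Lemma mul_Lfun1 (X Y : T -> R) :
  measurable_fun setT X -> measurable_fun setT Y ->
  (fun w => X w ^+ 2) \in Lfun P 1 -> (fun w => Y w ^+ 2) \in Lfun P 1 ->
  (fun w => X w * Y w) \in Lfun P 1.
Proof.
move=> mX mY LX LY.
apply: (@Lfun1_dominated _ (fun w => X w ^+ 2 + Y w ^+ 2)).
- exact: measurable_funM.
- exact: (rpredD LX LY).
- move=> w; rewrite normrM -(normr_id (X w)) -(real_normK (num_real (X w))).
  rewrite -(real_normK (num_real (Y w))) normr_id.
  move: `|X w| `|Y w| (normr_ge0 (X w)) (normr_ge0 (Y w)) => x y x0 y0.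
  nra.
Qed.

(** The constant 1 is square integrable for a probability, and X = X * 1. *)
Lemma Lfun1_of_sqr (X : T -> R) : measurable_fun setT X ->
  (fun w => X w ^+ 2) \in Lfun P 1 -> X \in Lfun P 1.
Proof.
move=> mX LX; rewrite (_ : X = fun w => X w * 1); last first.
  by apply/funext => w; rewrite mulr1.
apply: (mul_Lfun1 (Y := fun=> 1)) => //.
rewrite (_ : (fun _ => _) = fun=> 1) ?Lfun_cst//.
by apply/funext => w; rewrite expr1n.
Qed.

End HasMean.

(** * First and second moments of Borel probabilities on R^n *)

Section Moments.
Context (R : realType) (n : nat).

(** Open intervals generate the Borel sets of the line, and their preimages are open because
    coordinates are continuous. *)
Lemma measurable_component (i : 'I_n) :
  measurable_fun setT (component i : borel_cV R n -> R).
Proof.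
apply: (measurability _ (RGenOpens.measurableE R)) => _ [_ [a [b ->] <-]].
rewrite setTI; apply: sub_sigma_algebra.
have /continuousP := @coord_continuous R n 1 i 0.
by apply; exact: interval_open.
Qed.

Variable P : probability (borel_cV R n) R.
Hypothesis P2 : finite_second_moments P.

Lemma component_sqr_Lfun1 i : (fun w => component i w ^+ 2) \in Lfun P 1.
Proof. by apply: sqr_Lfun1 (P2 i); exact: measurable_component. Qed.

Lemma component_Lfun1 i : (component i : borel_cV R n -> R) \in Lfun P 1.
Proof.
by apply: Lfun1_of_sqr (component_sqr_Lfun1 i); exact: measurable_component.
Qed.

Lemma has_mean_centered i :
  has_mean P (fun w : borel_cV R n => component i w - mean P i 0) 0.
Proof.
rewrite -(subrr (mean P i 0)); apply: has_meanD; last exact: has_mean_cst.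
by rewrite mxE; apply: has_mean_fine; exact: component_Lfun1.
Qed.

(** The value is the definition of covariance; integrability follows by expanding the product into
    integrable terms. *)
Lemma has_mean_centered_mul i j :
  has_mean P (fun w : borel_cV R n =>
    (component i w - mean P i 0) * (component j w - mean P j 0)) (covmx P i j).
Proof.
rewrite !mxE covariance.unlock; apply: has_mean_fine.
set a := fine _; set b := fine _.
have Lb k c : (fun w : borel_cV R n => c * component k w) \in Lfun P 1.
  exact: (has_meanZ c (has_mean_fine (component_Lfun1 k))).1.
have LXY : (fun w : borel_cV R n => component i w * component j w) \in Lfun P 1.
  apply: mul_Lfun1; rewrite ?component_sqr_Lfun1//;
    exact: measurable_component.
rewrite (_ : (fun _ => _) = fun w : borel_cV R n =>
    component i w * component j w + (- b) * component i w +
    (- a) * component j w + a * b).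
  have Lab := Lfun_cst P (a * b) 1.
  exact: (rpredD (rpredD (rpredD LXY (Lb i _)) (Lb j _)) Lab).
by apply/funext => w; ring.
Qed.

(** Expansion around the mean: the quadratic part averages to the trace, the linear part to 0, and
    the constant part is the form at the mean of [N *m w + a]. *)
Lemma has_mean_qform m (M : 'M[R]_m) (N : 'M[R]_(m, n)) (a : 'cV[R]_m) :
  M^T = M ->
  has_mean P (fun w : borel_cV R n => qform M (N *m (w : 'cV[R]_n) + a))
    (\tr (covmx P *m (N^T *m M *m N)) + qform M (N *m mean P + a)).
Proof.
move=> MT; pose C := N^T *m M *m N; pose b := N *m mean P + a.
pose l := b^T *m M *m N.
have -> : (fun w : borel_cV R n => qform M (N *m (w : 'cV[R]_n) + a)) =
  (fun w : borel_cV R n =>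
    (\sum_i \sum_j C i j *
      ((component i w - mean P i 0) * (component j w - mean P j 0))
    + 2 * (\sum_j l 0 j * (component j w - mean P j 0))) + qform M b).
  apply/funext => w.
  have -> : N *m (w : 'cV[R]_n) + a = N *m (w - mean P) + b.
    by rewrite mulmxBr /b addrA subrK.
  rewrite qformD//; congr (_ + 2 * _ + _).
    rewrite -qform_congr -/C /qform -mulmxA mxE; apply: eq_bigr => i _.
    rewrite !mxE big_distrr; apply: eq_bigr => j _ /=.
    by rewrite !mxE; rewrite /component; ring.
  rewrite mulmxA -/l mxE; apply: eq_bigr => j _.
  by rewrite !mxE.
apply: has_meanD; last exact: has_mean_cst.
(* The added [2 * 0] is the mean of the linear part. *)
rewrite (_ : \tr _ = \tr (covmx P *m C) + 2 * 0); last by rewrite mulr0 addr0.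
apply: has_meanD.
  have -> : \tr (covmx P *m C) = \sum_i \sum_j C i j * covmx P i j.
    rewrite mxtrace_mulC; apply: eq_bigr => i _; rewrite mxE.
    apply: eq_bigr => j _; congr (_ * _); rewrite !mxE; congr fine.
    exact: covarianceC.
  apply: has_mean_sum => i; apply: has_mean_sum => j.
  exact/has_meanZ/has_mean_centered_mul.
apply: has_meanZ.
rewrite [X in has_mean _ _ X](_ : _ = \sum_j l 0 j * 0); last first.
  by rewrite big1// => j _; rewrite mulr0.
by apply: has_mean_sum => j; exact/has_meanZ/has_mean_centered.
Qed.

End Moments.

(** * Finitely supported probabilities and prescribed moments *)

Section Empirical.
Context d (T : measurableType d) (R : realType) (x : nat -> T) (N : nat).

(** The successor keeps the number of atoms positive, so that the weights add up to 1; repeated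
    points accumulate weight. *)
Definition empirical : set T -> \bar R :=
  msum (fun k => mscale (N.+1%:R^-1)%:nng (dirac (x k))) N.+1.

HB.instance Definition _ := Measure.on empirical.

Lemma empirical_setT : empirical setT = 1%E.
Proof.
rewrite /empirical /msum (eq_bigr (fun=> (N.+1%:R^-1)%:E)) => [|k _].
  rewrite sumEFin sumr_const card_ord -[_^-1 *+ _]mulr_natl.
  by rewrite divff// pnatr_eq0.
by rewrite /= /mscale /= diracT mule1.
Qed.

HB.instance Definition _ :=
  @Measure_isProbability.Build _ _ R empirical empirical_setT.

Lemma ge0_integral_empirical (f : T -> \bar R) :
  measurable_fun setT f -> (forall w, 0 <= f w)%E ->
  (\int[empirical]_w f w = \sum_(k < N.+1) N.+1%:R^-1%:E * f (x k))%E.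
Proof.
move=> mf f0; rewrite ge0_integral_measure_sum//.
apply: eq_bigr => k _; rewrite ge0_integral_mscale// integral_dirac//.
by rewrite diracT mul1e.
Qed.

Lemma has_mean_empirical (f : T -> R) : measurable_fun setT f ->
  has_mean empirical f (N.+1%:R^-1 * \sum_(k < N.+1) f (x k)).
Proof.
move=> mf; have mfe : measurable_fun setT (EFin \o f) by exact/measurable_EFinP.
split.
  apply/Lfun1_integrable/integrableP; split=> //.
  rewrite ge0_integral_empirical//; last exact: measurableT_comp.
  by under eq_bigr do rewrite -EFinM; rewrite sumEFin ltry.
(* The finite-sum formula is available for nonnegative functions, hence the split into positive and
   negative parts. *)
rewrite unlock integralE.
rewrite (_ : (fun w => (f w)%:E) = EFin \o f)// funerpos funerneg.
rewrite !ge0_integral_empirical//=; first last.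
- by move=> w; rewrite lee_fin funrpos_ge0.
- exact/measurable_EFinP/measurable_funrpos.
- by move=> w; rewrite lee_fin funrneg_ge0.
- exact/measurable_EFinP/measurable_funrneg.
under eq_bigr do rewrite -EFinM.
under [X in (_ - X)%E]eq_bigr do rewrite -EFinM.
rewrite !sumEFin -EFinB -sumrB big_distrr; congr EFin; apply: eq_bigr => k _ /=.
by rewrite -mulrBr -[in RHS](funrposBneg f).
Qed.
End Empirical.

Section Prescribed.
Variables (R : realType).

(* The uniform measure on the 2n points mu +- sqrt(n c_i) u_i, where the c_i are
   the eigenvalues of Sigma and the u_i orthonormal eigenvectors. *)
Lemma exists_moments n (mu : 'cV[R]_n) (Sigma : 'M[R]_n) :
  (0 < n)%N -> psdmx Sigma ->
  exists P : probability (borel_cV R n) R,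
    [/\ finite_second_moments P, mean P = mu & covmx P = Sigma].
Proof.
case: n mu Sigma => // n mu Sigma _ /psdmx_spectral[U [c [UU SE c0]]].
(* A pair of opposite points contributes 2 [y k *m (y k)^T] with weight 1 / (2 [n.+1]); the factor
   [n.+1] under the root cancels this weight. *)
pose y (k : nat) : 'cV[R]_n.+1 :=
  Num.sqrt (n.+1%:R * c 0 (inord k)) *: (row (inord k) U)^T.
pose x (k : nat) : borel_cV R n.+1 :=
  if (k < n.+1)%N then mu + y k else mu - y (k - n.+1)%N.
(* [empirical] takes the number of atoms minus one, here [n.+1 + n.+1] minus one. *)
pose P : probability (borel_cV R n.+1) R := empirical R x (n + n.+1).
have hm (f : borel_cV R n.+1 -> R) : measurable_fun setT f ->
    has_mean P f ((n.+1 + n.+1)%:R^-1 *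
      \sum_(k < n.+1) (f (mu + y k) + f (mu - y k))).
  move=> mf; have := has_mean_empirical x (n + n.+1) mf.
  rewrite -[(n + n.+1).+1]/(n.+1 + n.+1)%N big_split_ord /= -big_split /=.
  congr (has_mean P f (_ * _)); apply: eq_bigr => k _.
  by rewrite /x ltn_ord ltnNge leq_addr /= addKn.
have nE : (n.+1 + n.+1)%:R = 2 * n.+1%:R :> R by rewrite natrD; ring.
have n0 : n.+1%:R != 0 :> R by rewrite pnatr_eq0.
have meanE : mean P = mu.
  apply/colP => i; rewrite mxE; have [_ ->] := hm _ (measurable_component i).
  rewrite /= (eq_bigr (fun=> 2 * mu i 0)) => [|k _].
    by rewrite sumr_const card_ord -mulr_natl nE; field.
  by rewrite /component !mxE; ring.
exists P; split=> //.
  move=> i; have mi := measurable_funX 2 (@measurable_component R n.+1 i).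
  by have [_ ->] := hm _ mi; rewrite ltry.
apply/matrixP => i j; rewrite mxE covariance.unlock.
have mi k : measurable_fun setT
    (component k \- cst (fine 'E_P[component k]%E) : borel_cV R n.+1 -> R).
  by apply: measurable_funB => //; exact: measurable_component.
have [_ ->] := hm _ (measurable_funM (mi i) (mi j)).
have mE k : fine 'E_P[component k]%E = mu k 0 by rewrite -meanE mxE.
rewrite /= !mE SE -mulmxA mul_diag_mx !mxE.
rewrite (eq_bigr (fun k => 2 * n.+1%:R * (U k i * (c 0 k * U k j)))) => [|k _].
  rewrite -big_distrr /= nE mulrA mulVf ?mulf_neq0 ?pnatr_eq0// mul1r.
  by apply: eq_bigr => k _; rewrite !mxE.
rewrite /component !mxE inord_val.
have : Num.sqrt (n.+1%:R * c 0 k) ^+ 2 = n.+1%:R * c 0 k.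
  by rewrite sqr_sqrtr ?mulr_ge0.
move: (Num.sqrt _) => s; move: (n.+1%:R) => N sE.
transitivity (2 * s ^+ 2 * (U k i * U k j)); first by ring.
by rewrite sE; ring.
Qed.
End Prescribed.

(** * Worst-case regret *)

Section Value.
Variable R : realType.

Lemma qformZ n (M : 'M[R]_n) (s : R) (x : 'cV[R]_n) :
  qform M (s *: x) = s ^+ 2 * qform M x.
Proof.
rewrite /qform -scalemxAr [(s *: x)^T]linearZ /= -!scalemxAl scalerA.
by rewrite mxE expr2.
Qed.

(** The sign is chosen to make the cross term nonnegative; the form at [y] is nonnegative too. *)
Lemma qform_sign_le n (M : 'M[R]_n) (x y : 'cV[R]_n) : psdmx M ->
  exists s : R, s ^+ 2 = 1 /\ qform M x <= qform M (s *: x + y).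
Proof.
move=> [MT M0]; have y0 := M0 y.
have le s : s ^+ 2 = 1 -> 0 <= s * (y^T *m M *m x) 0 0 ->
    qform M x <= qform M (s *: x + y).
  by move=> s1 sxy; rewrite qformD// qformZ s1 -scalemxAr mxE; lra.
have [xy0|/ltW xy0] := leP 0 ((y^T *m M *m x) 0 0).
  by exists 1; split; [rewrite expr1n | apply: le; rewrite ?expr1n ?mul1r].
exists (-1); rewrite sqrrN expr1n; split=> //.
by apply: le; rewrite ?sqrrN ?expr1n// mulN1r oppr_ge0.
Qed.

Lemma schatten_ge0 n (M : 'M[R]_n) p : M^T = M -> 0 <= schatten p M.
Proof.
move=> /spectral_sym[U [c [UU ME]]].
by rewrite (schatten_spectral p UU ME) lpnorm_ge0.
Qed.

Lemma covmx_sym n (P : probability (borel_cV R n) R) : (covmx P)^T = covmx P.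
Proof. by apply/matrixP => i j; rewrite !mxE covarianceC. Qed.

Section Bounds.
Variables (m n : nat) (M : 'M[R]_m) (N : 'M[R]_(m, n)).
Variables (r1 r2 : R) (p q : \bar R).
Variables (muh : 'cV[R]_n) (Sigmah : 'M[R]_n).
Hypotheses (hM : psdmx M) (hr1 : 0 <= r1) (hr2 : 0 <= r2).
Hypotheses (hp : (1 <= p)%E) (hq : (1 <= q)%E) (hpq : (p^-1 + q^-1 = 1)%E).
Hypothesis hSigmah : psdmx Sigmah.
Local Notation C := (N^T *m M *m N).
Local Notation value :=
  (\tr (Sigmah *m C) + r1 * schatten +oo%E C + r2 * schatten q C).

(** With the offset [- N *m muh], the mean enters only through its deviation from [muh], controlled
    by the operator norm; trace duality handles the deviation of the covariance. *)
Lemma expected_qform_le (P : probability (borel_cV R n) R) :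
  ambiguity p r1 r2 muh Sigmah P ->
  \tr (covmx P *m C) + qform M (N *m (mean P - muh)) <= value.
Proof.
move=> [_ hmu hSigma]; have [CT _] := psdmx_congr N hM.
have := qform_le_schatten (mean P - muh) CT; rewrite qform_congr.
have := ler_wpM2l (schatten_ge0 +oo CT) hmu.
have ST : (covmx P - Sigmah)^T = covmx P - Sigmah.
  by rewrite linearB /= covmx_sym hSigmah.1.
have := tr_schatten_le hp hq hpq ST CT; rewrite mulmxBl (raddfB (@mxtrace R n)).
have := ler_wpM2r (schatten_ge0 q CT) hSigma.
lra.
Qed.

(** Whatever the offset [v], an adversary can shift the covariance by an extremal [Delta] and the
    mean along a top eigenvector of [C]. *)
Lemma expected_qform_ge (v : 'cV[R]_m) : (0 < n)%N ->
  exists P : probability (borel_cV R n) R, ambiguity p r1 r2 muh Sigmah P /\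
    value <= \tr (covmx P *m C) + qform M (N *m mean P + v).
Proof.
move=> n0; have hC := psdmx_congr N hM.
have [Delta [hDelta Delta_le trDelta]] := tr_schatten_attained hp hq hpq hr2 hC.
have [x [x1 Cx]] := qform_schatten_attained n0 hC.
(* Scaling the unit vector by [Num.sqrt r1] exhausts the radius allowed for the mean; [v] influences
   only the sign [s]. *)
have [s [s1 sx]] := qform_sign_le (N *m (Num.sqrt r1 *: x)) (N *m muh + v) hM.
have [P [P2 meanP covP]] := exists_moments (muh + s *: (Num.sqrt r1 *: x)) n0
  (psdmxD hSigmah hDelta).
exists P; split; first split=> //.
- rewrite meanP addrC addKr norm2_sqr.
  under eq_bigr do rewrite !mxE !exprMn s1 mul1r sqr_sqrtr//.
  by rewrite -big_distrr /= -norm2_sqr x1 mulr1.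
- by rewrite covP addrC addKr.
- rewrite meanP covP mulmxDl mxtraceD trDelta.
  have -> : N *m (muh + s *: (Num.sqrt r1 *: x)) + v =
      s *: (N *m (Num.sqrt r1 *: x)) + (N *m muh + v).
    by rewrite mulmxDr -scalemxAr addrAC addrC.
  move: sx; rewrite -[X in qform M X <= _]scalemxAr qformZ sqr_sqrtr//.
  rewrite -qform_congr Cx.
  lra.
Qed.
End Bounds.
End Value.

Theorem theorem2 (R : realType) (T nx nu : nat)
    (hT : (0 < T)%N) (hnx : (0 < nx)%N) (hnu : (0 < nu)%N)
    (A : 'I_T -> 'M[R]_nx) (B : 'I_T -> 'M[R]_(nx, nu))
    (Q : 'M[R]_(stack_dim T.+1 nx)) (Rm : 'M[R]_(stack_dim T nu))
    (hQ : psdmx Q) (hRm : pdmx Rm)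
    (r1 r2 : R) (hr1 : 0 <= r1) (hr2 : 0 <= r2)
    (p q : \bar R) (hp : (1 <= p)%E) (hq : (1 <= q)%E)
    (hpq : (p^-1 + q^-1 = 1)%E)
    (muh : 'cV[R]_(stack_dim T.+1 nx))
    (Sigmah : 'M[R]_(stack_dim T.+1 nx)) (hSigmah : psdmx Sigmah)
    (Kstar : 'M[R]_(stack_dim T nu, stack_dim T.+1 nx))
    (hKstar : is_argmin (@causal R T nx nu)
       (fun K => let C := Cmx A B Q Rm K in
          \tr (Sigmah *m C) + r1 * schatten +oo%E C + r2 * schatten q C)
       Kstar) :
  is_argmin (@policies R T nx nu)
    (fun phi => ereal_sup
       [set 'E_P[(fun w => regret A B Q Rm (phi w) w)%R]%E
       | P in ambiguity p r1 r2 muh Sigmah])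
    (fun w => Kstar *m (w - muh) + Ko A B Q Rm *m muh).
Proof.
(* A nonzero dimension provides the unit eigenvector used by the adversary. *)
have n0 : (0 < stack_dim T.+1 nx)%N by rewrite sum_nat_const card_ord muln_gt0.
have DP := pdmx_psdmx (Dmx_pd A B hQ hRm).
set f := (fun K => let C := Cmx A B Q Rm K in _) in hKstar.
have EP K v (P : probability (borel_cV R (stack_dim T.+1 nx)) R) :
    finite_second_moments P ->
    ('E_P[(fun w => regret A B Q Rm (K *m w + v) w)%R] =
    (\tr (covmx P *m Cmx A B Q Rm K) +
     qform (Dmx A B Q Rm) ((K - Ko A B Q Rm) *m mean P + v))%:E)%E.
  move=> P2; rewrite -(has_mean_qform P2 (K - Ko A B Q Rm) v DP.1).2.
  congr expectation; apply/funext => w.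
  by rewrite regretE// mulmxBl addrAC.
have -> : (fun w => Kstar *m (w - muh) + Ko A B Q Rm *m muh) =
    fun w => Kstar *m w + (Ko A B Q Rm - Kstar) *m muh.
  by apply/funext => w; rewrite mulmxBr mulmxBl addrA addrAC.
split.
  by exists ((Ko A B Q Rm - Kstar) *m muh), Kstar; split; first exact: hKstar.1.
move=> _ [v [K [hK ->]]].
(* The chain is: worst case of the candidate <= [f Kstar] <= [f K] <= worst case of the policy given
   by [K] and [v]. *)
apply: (@le_trans _ _ (f Kstar)%:E).
  apply: ge_ereal_sup => _ [P hP <-]; rewrite EP; last by case: hP.
  rewrite (_ : _ + (_ - _) *m muh = (Kstar - Ko A B Q Rm) *m (mean P - muh)).
    exact: (expected_qform_le _ DP hp hq hpq hSigmah hP).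
  by rewrite mulmxBr -mulNmx opprB.
apply: (@le_trans _ _ (f K)%:E); first by rewrite lee_fin; exact: hKstar.2.
(* One adversarial measure suffices, since the supremum dominates its expected regret. *)
have [P [hP le_P]] := expected_qform_ge (K - Ko A B Q Rm) muh DP hr1 hr2
  hp hq hpq hSigmah v n0.
apply: le_trans (ereal_sup_ubound _); last by exists P.
by rewrite EP ?lee_fin//; case: hP.
Qed.
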